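(* The conditional term rewriting systems $\mathrm{CLC}$ and $\mathrm{CLC}^+$ are confluent: for each $R\in\{\mathrm{CLC},\mathrm{CLC}^+\}$ and all terms $q,q_1,q_2$, if $q\to_R^* q_1$ and $q\to_R^* q_2$ then there is a term $q'$ with $q_1\to_R^* q'$ and $q_2\to_R^* q'$.
   Context: Terms are built from variables and the constants $C,T,F,K,S$ by binary application (written by juxtaposition, associating to the left). $\mathrm{CLC}$ is the conditional term rewriting system with rules $C\,T\,x\,y\to x$; $C\,F\,x\,y\to y$; $C\,z\,x\,y\to x \Leftarrow x=y$; $K\,x\,y\to x$; $S\,x\,y\,z\to x\,z\,(y\,z)$, where the equality $=$ in the condition is convertibility in the system itself. Formally: let $R_0$ be the system with the condition interpreted as the empty relation, and $R_{n+1}$ the system with $=$ interpreted as the conversion relation (reflexive–symmetric–transitive closure) of $\to_{R_n}$; then $q\to_{\mathrm{CLC}} q'$ iff $q\to_{R_n}q'$ for some $n$. Rewriting is closed under contexts. $\mathrm{CLC}^+$ is defined in the same way from the rules of $\mathrm{CLC}$ together with the additional rule $C\,z\,x\,y\to y\Leftarrow x=y$. For a rewrite system $R$, $\to_R^*$ is the reflexive–transitive closure of $\to_R$ and $=_R$ the conversion relation. *)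

(* Defs.v *)
From Stdlib Require Import Relations.

Inductive term : Type :=
| Var : nat -> term
| Cc : term
| Tc : term
| Fc : term
| Kc : term
| Sc : term
| App : term -> term -> term.

(* One-step rewriting of the system whose conditional rules use the relation
   [cond] to interpret "=" in the condition.  The flag [plus] selects whether
   the extra rule  C z x y -> y <= x = y  of CLC+ is present. Closed under
   contexts. *)
Inductive rstep (plus : bool) (cond : relation term) : relation term :=
| r_CT : forall x y, rstep plus cond (App (App (App Cc Tc) x) y) x
| r_CF : forall x y, rstep plus cond (App (App (App Cc Fc) x) y) y
| r_Cz : forall z x y, cond x y -> rstep plus cond (App (App (App Cc z) x) y) x
| r_Cz' : forall z x y, plus = true -> cond x y ->
          rstep plus cond (App (App (App Cc z) x) y) y
| r_K : forall x y, rstep plus cond (App (App Kc x) y) x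
| r_S : forall x y z, rstep plus cond (App (App (App Sc x) y) z)
                                       (App (App x z) (App y z))
| r_appl : forall t t' u, rstep plus cond t t' -> rstep plus cond (App t u) (App t' u)
| r_appr : forall t u u', rstep plus cond u u' -> rstep plus cond (App t u) (App t u').

Fixpoint level (plus : bool) (n : nat) : relation term :=
  match n with
  | 0 => rstep plus (fun _ _ => False)
  | S m => rstep plus (clos_refl_sym_trans term (level plus m))
  end.

Definition clc_step (plus : bool) : relation term :=
  fun q q' => exists n, level plus n q q'.

Definition clc_steps (plus : bool) : relation term :=
  clos_refl_trans term (clc_step plus).

(* Main.v *)
Require Import Defs.
From Stdlib Require Import Relations List Classical.
Import ListNotations.

(** Write [=] for convertibility.  The only harmful overlap is between
    [C F x y -> y] and [C F x y -> x], where [x = y].  It disappears if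
    [C z x y] is contracted to [y] whenever [z = F], and to [x] when [x = y]
    and not [z = F]: the conditions are invariant under reduction, the system
    is orthogonal, hence confluent, and it generates [=] again.  Each of its
    steps is a reduction of the original system as soon as [z = F] implies
    that [z] reduces to [F].

    The latter is an adequacy property of a head evaluation in which the
    conditional rule of [C z x y] requires that [x = y] and that both branches,
    applied to the remaining arguments, evaluate to the same truth value.
    Because both branches are evaluated, contracting to either of them
    preserves the value, so evaluation is invariant under [=]. *)

Notation Capp z x y := (App (App (App Cc z) x) y).

Definition conv (plus : bool) : relation term :=
  clos_refl_sym_trans term (clc_step plus).

(** * Levels and conversion *)

Lemma rstep_mono plus (c1 c2 : relation term) :
  inclusion term c1 c2 -> inclusion term (rstep plus c1) (rstep plus c2).
Proof.
  intros H t u Hs; induction Hs; constructor; auto.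
Qed.

Lemma crst_mono (R1 R2 : relation term) :
  inclusion term R1 R2 ->
  inclusion term (clos_refl_sym_trans term R1) (clos_refl_sym_trans term R2).
Proof.
  intros H t u Hs; induction Hs.
  - apply rst_step; auto.
  - apply rst_refl.
  - apply rst_sym; auto.
  - eapply rst_trans; eauto.
Qed.

Lemma level_S plus n : inclusion term (level plus n) (level plus (S n)).
Proof.
  induction n as [|n IH].
  - apply rstep_mono; intros x y [].
  - apply rstep_mono, crst_mono, IH.
Qed.

Lemma level_le plus m n :
  m <= n -> inclusion term (level plus m) (level plus n).
Proof.
  induction 1 as [|n _ IH]; intros t u H; auto.
  apply level_S, IH, H.
Qed.

(** A conversion consists of finitely many steps, so the largest of their levels serves for all of
    them; a condition in [conv] is thus met at a single level. *)
Lemma conv_level plus x y :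
  conv plus x y -> exists n, clos_refl_sym_trans term (level plus n) x y.
Proof.
  induction 1 as [x y [n H]|x|x y _ [n IH]|x y z _ [n IH1] _ [m IH2]].
  - exists n; apply rst_step, H.
  - exists 0; apply rst_refl.
  - exists n; apply rst_sym, IH.
  - exists (max n m); eapply rst_trans.
    + eapply crst_mono, IH1; apply level_le, PeanoNat.Nat.le_max_l.
    + eapply crst_mono, IH2; apply level_le, PeanoNat.Nat.le_max_r.
Qed.

Lemma step_cond plus z x y : conv plus x y -> clc_step plus (Capp z x y) x.
Proof.
  intros H; destruct (conv_level _ _ _ H) as [n Hn].
  exists (S n); apply r_Cz, Hn.
Qed.

Lemma rstep_False_step plus t u :
  rstep plus (fun _ _ => False) t u -> clc_step plus t u.
Proof. exists 0; assumption. Qed.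

Lemma step_appl plus t t' u :
  clc_step plus t t' -> clc_step plus (App t u) (App t' u).
Proof. intros [[|n] H]; [exists 0|exists (S n)]; apply r_appl, H. Qed.

Lemma step_appr plus t u u' :
  clc_step plus u u' -> clc_step plus (App t u) (App t u').
Proof. intros [[|n] H]; [exists 0|exists (S n)]; apply r_appr, H. Qed.

Lemma steps_app plus t t' u u' :
  clc_steps plus t t' -> clc_steps plus u u' ->
  clc_steps plus (App t u) (App t' u').
Proof.
  intros Ht Hu; apply rt_trans with (App t' u).
  - induction Ht; [apply rt_step, step_appl|apply rt_refl|eapply rt_trans];
      eassumption.
  - clear Ht; induction Hu;
      [apply rt_step, step_appr|apply rt_refl|eapply rt_trans]; eassumption.
Qed.

Lemma steps_conv plus t u : clc_steps plus t u -> conv plus t u.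
Proof. apply clos_rt_clos_rst. Qed.

Lemma conv_app plus t t' u u' :
  conv plus t t' -> conv plus u u' -> conv plus (App t u) (App t' u').
Proof.
  intros Ht Hu; apply rst_trans with (App t' u).
  - induction Ht; [apply rst_step, step_appl|apply rst_refl|apply rst_sym
                  |eapply rst_trans]; eassumption.
  - clear Ht; induction Hu; [apply rst_step, step_appr|apply rst_refl
                            |apply rst_sym|eapply rst_trans]; eassumption.
Qed.

(** * Equational theories containing conversion *)

Record clc_theory (Q : relation term) : Prop := {
  th_refl : forall t, Q t t;
  th_sym : forall t u, Q t u -> Q u t;
  th_trans : forall t u v, Q t u -> Q u v -> Q t v;
  th_appl : forall t t' u, Q t t' -> Q (App t u) (App t' u);
  th_appr : forall t u u', Q u u' -> Q (App t u) (App t u');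
  th_CT : forall x y, Q (Capp Tc x y) x;
  th_CF : forall x y, Q (Capp Fc x y) y;
  th_K : forall x y, Q (App (App Kc x) y) x;
  th_S : forall x y z,
    Q (App (App (App Sc x) y) z) (App (App x z) (App y z));
  th_C : forall z x y, Q x y -> Q (Capp z x y) x }.

(** Induction on the level: once the conditions of a level lie in [Q], so do its steps and hence its
    conversions, which are the conditions of the next level. It is applied to [ev_equiv] and to
    [joinable]. *)
Lemma conv_least plus Q : clc_theory Q -> inclusion term (conv plus) Q.
Proof.
  intros HQ.
  assert (Hcl : forall R, inclusion term R Q ->
    inclusion term (clos_refl_sym_trans term R) Q).
  { intros R HR t u H; induction H.
    - apply HR; assumption.
    - apply (th_refl _ HQ).
    - apply (th_sym _ HQ); assumption.
    - eapply (th_trans _ HQ); eassumption. }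
  assert (Hr : forall c, inclusion term c Q ->
    inclusion term (rstep plus c) Q).
  { intros c Hc t u H; induction H.
    - apply (th_CT _ HQ).
    - apply (th_CF _ HQ).
    - apply (th_C _ HQ); auto.
    (* The extra rule of CLC+ yields [y], which [Q] links to [C z x y] through [x]; so one record
       serves both systems. *)
    - apply (th_trans _ HQ) with x; auto; apply (th_C _ HQ); auto.
    - apply (th_K _ HQ).
    - apply (th_S _ HQ).
    - apply (th_appl _ HQ); auto.
    - apply (th_appr _ HQ); auto. }
  apply Hcl; intros t u [n H]; revert t u H.
  induction n as [|n IH]; apply Hr; [intros ? ? []|exact (Hcl _ IH)].
Qed.

(** * Evaluation to a truth value *)

Section Evaluation.

Variable plus : bool.

(* [ev t rs b]: the term [t] applied to the stack [rs] evaluates to [b]. *)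
Inductive ev : term -> list term -> bool -> Prop :=
| ev_T : ev Tc [] true
| ev_F : ev Fc [] false
| ev_App f t rs b : ev f (t :: rs) b -> ev (App f t) rs b
| ev_K x y rs b : ev x rs b -> ev Kc (x :: y :: rs) b
| ev_S x y z rs b : ev x (z :: App y z :: rs) b -> ev Sc (x :: y :: z :: rs) b
| ev_CT z x y rs b : ev z [] true -> ev x rs b -> ev Cc (z :: x :: y :: rs) b
| ev_CF z x y rs b : ev z [] false -> ev y rs b -> ev Cc (z :: x :: y :: rs) b
| ev_Cz z x y rs b : conv plus x y -> ev x rs b -> ev y rs b ->
    ev Cc (z :: x :: y :: rs) b.

Definition apps (t : term) (rs : list term) : term := fold_left App rs t.

Lemma steps_apps t t' rs :
  clc_steps plus t t' -> clc_steps plus (apps t rs) (apps t' rs).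
Proof.
  revert t t'; induction rs as [|r rs IH]; simpl; intros t t' H; auto.
  apply IH, steps_app; [exact H|apply rt_refl].
Qed.

Lemma step_apps t t' rs u :
  clc_step plus t t' -> clc_steps plus (apps t' rs) u ->
  clc_steps plus (apps t rs) u.
Proof.
  intros H; apply rt_trans, steps_apps, rt_step, H.
Qed.

(** The clauses for [K], [S] and [C] are head reductions; for [ev_CT] and [ev_CF] the guard is first
    reduced in place to [Tc] or [Fc]. [ev_Cz] follows the first branch, a step that both systems
    have. *)
Lemma ev_sound t rs b :
  ev t rs b -> clc_steps plus (apps t rs) (if b then Tc else Fc).
Proof.
  induction 1; simpl in *; try (apply rt_refl); try assumption.
  - eapply step_apps; [apply rstep_False_step, r_K|assumption].
  - eapply step_apps; [apply rstep_False_step, r_S|assumption].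
  - apply rt_trans with (apps (Capp Tc x y) rs).
    + apply steps_apps; repeat apply steps_app; auto; apply rt_refl.
    + eapply step_apps; [apply rstep_False_step, r_CT|assumption].
  - apply rt_trans with (apps (Capp Fc x y) rs).
    + apply steps_apps; repeat apply steps_app; auto; apply rt_refl.
    + eapply step_apps; [apply rstep_False_step, r_CF|assumption].
  - eapply step_apps; [apply step_cond|]; eassumption.
Qed.

(** Conversion is included since [ev_Cz], which gives closure under [th_C], has it as a premise. *)
Definition ev_equiv : relation term := fun t u =>
  conv plus t u /\ forall rs b, ev t rs b <-> ev u rs b.

Lemma ev_equiv_refl t : ev_equiv t t.
Proof. split; [apply rst_refl|tauto]. Qed.

Lemma ev_equiv_sym t u : ev_equiv t u -> ev_equiv u t.
Proof.
  intros [H1 H2]; split; [apply rst_sym, H1|intros; symmetry; apply H2].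
Qed.

Lemma ev_equiv_trans t u v : ev_equiv t u -> ev_equiv u v -> ev_equiv t v.
Proof.
  intros [H1 H2] [H3 H4]; split; [eapply rst_trans; eassumption|].
  intros rs b; rewrite H2; apply H4.
Qed.

Lemma ev_App_iff f t rs b : ev (App f t) rs b <-> ev f (t :: rs) b.
Proof. split; [inversion 1; auto|apply ev_App]. Qed.

Lemma ev_equiv_appl t t' u :
  ev_equiv t t' -> ev_equiv (App t u) (App t' u).
Proof.
  intros [H1 H2]; split; [apply conv_app; [exact H1|apply rst_refl]|].
  intros rs b; rewrite !ev_App_iff; apply H2.
Qed.

(** * Replacement of equivalent subterms in arguments *)

Inductive compat : relation term :=
| compat_equiv t u : ev_equiv t u -> compat t u
| compat_app f f' t t' : compat f f' -> compat t t' ->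
    compat (App f t) (App f' t').

(** The head atom stays fixed and only arguments change, so a term and its replacement are evaluated
    by the same clause. *)
Inductive compat_args : relation term :=
| args_atom h : (forall f t, h <> App f t) -> compat_args h h
| args_app f f' t t' : compat_args f f' -> compat t t' ->
    compat_args (App f t) (App f' t').

Lemma compat_args_refl t : compat_args t t.
Proof.
  induction t; try (apply args_atom; discriminate).
  apply args_app; [assumption|apply compat_equiv, ev_equiv_refl].
Qed.

(* Replacements at a prefix of the spine can be postponed: [ev_equiv] is closed
   under further arguments. *)
Lemma compat_split t u :
  compat t u -> exists v, compat_args t v /\ ev_equiv v u.
Proof.
  induction 1 as [t u H|f f' t t' _ [v [H1 H2]] H _].
  - exists t; split; [apply compat_args_refl|assumption].
  - exists (App v t'); split; [apply args_app; assumption|].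
    apply ev_equiv_appl, H2.
Qed.

Lemma compat_conv t u : compat t u -> conv plus t u.
Proof. induction 1 as [t u [H _]|]; auto using conv_app. Qed.

Lemma ev_compat_of_args x rs b :
  (forall x' rs', compat_args x x' -> Forall2 compat rs rs' -> ev x' rs' b) ->
  forall x' rs', compat x x' -> Forall2 compat rs rs' -> ev x' rs' b.
Proof.
  intros H x' rs' Hx Hrs.
  destruct (compat_split _ _ Hx) as [v [H1 [_ H2]]].
  apply H2, H; assumption.
Qed.

Ltac inv_args :=
  repeat match goal with
  | H : Forall2 _ [] _ |- _ => inversion H; clear H; subst
  | H : Forall2 _ (_ :: _) _ |- _ => inversion H; clear H; subst
  | H : compat_args _ _ |- _ => inversion H; clear H; subst
  end.

(** Induction on the evaluation. The fixed head selects the same clause; an argument that becomes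
    the new head is only related by [compat], and [ev_compat_of_args] adapts the induction
    hypothesis to this. *)
Lemma ev_compat_args t rs b :
  ev t rs b -> forall t' rs',
  compat_args t t' -> Forall2 compat rs rs' -> ev t' rs' b.
Proof.
  induction 1; intros t' rs' Ht Hrs.
  - inv_args; constructor.
  - inv_args; constructor.
  - inversion Ht as [? Hn|]; subst; [now destruct (Hn f t)|].
    apply ev_App, IHev; auto.
  - inv_args; apply ev_K; eapply ev_compat_of_args; eauto.
  - inv_args; apply ev_S; eapply ev_compat_of_args; eauto.
    (* [S] builds the new argument [App y z]; closure of [compat] under application covers it. *)
    apply Forall2_cons; auto using Forall2_cons, compat_app.
  - inv_args; apply ev_CT; eapply ev_compat_of_args; eauto.
  - inv_args; apply ev_CF; eapply ev_compat_of_args; eauto.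
  - inv_args; apply ev_Cz.
    (* The condition carries over, as the new branches are convertible to the old ones. *)
    + eapply rst_trans; [apply rst_sym, compat_conv; eassumption|].
      eapply rst_trans; [eassumption|apply compat_conv; assumption].
    + apply (ev_compat_of_args x rs); assumption.
    + apply (ev_compat_of_args y rs); assumption.
Qed.

Lemma ev_compat t t' rs b : ev t rs b -> compat t t' -> ev t' rs b.
Proof.
  intros H Ht; eapply ev_compat_of_args; eauto using ev_compat_args.
  clear; induction rs; constructor; auto using compat_equiv, ev_equiv_refl.
Qed.

Lemma ev_equiv_theory : clc_theory ev_equiv.
Proof.
  assert (Happr : forall t u u' rs b, ev_equiv u u' ->
    ev (App t u) rs b -> ev (App t u') rs b).
  { intros t u u' rs b Hu H; eapply ev_compat; [eassumption|].
    apply compat_app; apply compat_equiv; [apply ev_equiv_refl|assumption]. }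
  assert (Hrule : forall t u, rstep plus (fun _ _ => False) t u ->
    conv plus t u).
  { intros; apply rst_step, rstep_False_step; assumption. }
  split.
  - apply ev_equiv_refl.
  - apply ev_equiv_sym.
  - apply ev_equiv_trans.
  - apply ev_equiv_appl.
  - intros t u u' H; split; [apply conv_app; [apply rst_refl|apply H]|].
    intros rs b; split; apply Happr; auto using ev_equiv_sym.
  - intros x y; split; [apply Hrule, r_CT|intros rs b].
    rewrite !ev_App_iff; split; intros H.
    + inversion H; subst; try assumption.
      match goal with H' : ev Tc _ false |- _ => inversion H' end.
    + apply ev_CT; [constructor|assumption].
  - intros x y; split; [apply Hrule, r_CF|intros rs b].
    rewrite !ev_App_iff; split; intros H.
    (* In the case [ev_Cz] the evaluation of [y] is a premise; this is why both branches are
       evaluated there. *)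
    + inversion H; subst; try assumption.
      match goal with H' : ev Fc _ true |- _ => inversion H' end.
    + apply ev_CF; [constructor|assumption].
  - intros x y; split; [apply Hrule, r_K|intros rs b].
    rewrite !ev_App_iff; split; intros H;
      [inversion H; assumption|apply ev_K, H].
  - intros x y z; split; [apply Hrule, r_S|intros rs b].
    rewrite !ev_App_iff; split; intros H;
      [inversion H; assumption|apply ev_S, H].
  - intros z x y [Hxy Hev]; split; [apply rst_step, step_cond, Hxy|].
    intros rs b; rewrite !ev_App_iff; split; intros H.
    (* Whichever branch was evaluated, [Hev] turns its value into that of [x]. *)
    + inversion H; subst; try assumption; apply Hev; assumption.
    + apply ev_Cz; [assumption|assumption|apply Hev; assumption].
Qed.

(** [Fc] evaluates to false, evaluation is invariant under conversion, and [ev_sound] turns the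
    value back into a reduction. This makes the rule guarded by [z = F] a reduction of the original
    system. *)
Lemma conv_F_steps t : conv plus t Fc -> clc_steps plus t Fc.
Proof.
  intros H; apply (conv_least _ _ ev_equiv_theory) in H; destruct H as [_ H].
  apply (ev_sound t [] false), H; constructor.
Qed.

Lemma not_conv_T_F : ~ conv plus Tc Fc.
Proof.
  intros H; apply (conv_least _ _ ev_equiv_theory) in H; destruct H as [_ H].
  assert (HF : ev Fc [] true) by (apply H; constructor).
  inversion HF.
Qed.

End Evaluation.

(** * The orthogonal system *)

Section Orthogonal.

Variable plus : bool.

(** The conditions refer to [conv], fixed beforehand, and not to conversion by these rules; hence no
    levels arise. *)
Inductive rule : relation term :=
| rule_T x y : rule (Capp Tc x y) x
| rule_F z x y : conv plus z Fc -> rule (Capp z x y) y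
| rule_C z x y : conv plus x y -> ~ conv plus z Fc -> rule (Capp z x y) x
| rule_K x y : rule (App (App Kc x) y) x
| rule_S x y z : rule (App (App (App Sc x) y) z) (App (App x z) (App y z)).

Lemma rule_steps t u : rule t u -> clc_steps plus t u.
Proof.
  destruct 1.
  - apply rt_step, rstep_False_step, r_CT.
  - apply rt_trans with (Capp Fc x y).
    + repeat apply steps_app; try apply rt_refl; apply conv_F_steps, H.
    + apply rt_step, rstep_False_step, r_CF.
  - apply rt_step, step_cond, H.
  - apply rt_step, rstep_False_step, r_K.
  - apply rt_step, rstep_False_step, r_S.
Qed.

(** [rule_T] and [rule_F] exclude each other by [not_conv_T_F], [rule_F] and [rule_C] by the negated
    condition; [rule_T] and [rule_C] give the same contractum. *)
Lemma rule_functional t u v : rule t u -> rule t v -> u = v.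
Proof.
  pose proof (not_conv_T_F plus) as HTF.
  intros Hu Hv; destruct Hu; inversion Hv; subst; tauto.
Qed.

(** * Parallel reduction *)

Inductive par : relation term :=
| par_atom h : (forall f t, h <> App f t) -> par h h
| par_app f f' t t' : par f f' -> par t t' -> par (App f t) (App f' t')
| par_rule f f' t t' u : par f f' -> par t t' -> rule (App f' t') u ->
    par (App f t) u.

Lemma par_refl t : par t t.
Proof.
  induction t; try (apply par_atom; discriminate); apply par_app; assumption.
Qed.

Lemma par_steps t u : par t u -> clc_steps plus t u.
Proof.
  induction 1.
  - apply rt_refl.
  - apply steps_app; assumption.
  - eapply rt_trans; [apply steps_app; eassumption|apply rule_steps; assumption].
Qed.

Lemma par_conv t u : par t u -> conv plus t u.
Proof. intros H; apply steps_conv, par_steps, H. Qed.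

Lemma par_atom_inv h u : (forall f t, h <> App f t) -> par h u -> u = h.
Proof.
  intros Hh H; destruct H as [| |]; [reflexivity| |]; exfalso; eapply Hh;
    reflexivity.
Qed.

Lemma par_app1_inv h x u :
  (forall f t, h <> App f t) -> par (App h x) u ->
  exists x', u = App h x' /\ par x x'.
Proof.
  intros Hh H; inversion H as [? Hn|? f' ? x' Hf Hx|? f' ? x' ? Hf Hx Hr]; subst.
  - now destruct (Hn h x).
  - apply par_atom_inv in Hf; subst; eauto.
  - apply par_atom_inv in Hf; subst; auto.
    inversion Hr; subst; exfalso; eapply Hh; reflexivity.
Qed.

(** The rules for [C] and [S] consume three arguments, so with two there is no root contraction,
    even after inner steps. *)
Lemma par_app2_inv h x y u :
  h = Cc \/ h = Sc -> par (App (App h x) y) u ->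
  exists x' y', u = App (App h x') y' /\ par x x' /\ par y y'.
Proof.
  intros Hh H.
  assert (Ha : forall f t, h <> App f t) by (destruct Hh; subst; discriminate).
  inversion H as [? Hn|? f' ? y' Hf Hy|? f' ? y' ? Hf Hy Hr]; subst.
  - now destruct (Hn (App h x) y).
  - apply par_app1_inv in Hf as [x' [-> Hx]]; eauto.
  - apply par_app1_inv in Hf as [x' [-> Hx]]; auto.
    destruct Hh; subst; inversion Hr.
Qed.

Lemma conv_resp t t' u u' :
  par t t' -> par u u' -> (conv plus t u <-> conv plus t' u').
Proof.
  intros Ht Hu; apply par_conv in Ht, Hu; split; intros H.
  - eapply rst_trans; [apply rst_sym, Ht|].
    eapply rst_trans; [exact H|exact Hu].
  - eapply rst_trans; [exact Ht|].
    eapply rst_trans; [exact H|apply rst_sym, Hu].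
Qed.

(** No rule applies at a proper prefix of the spine of a left-hand side, so inner steps keep its
    shape; the conditions persist because [par] lies in [conv]. Hence the same rule still
    applies. *)
Lemma rule_par f f' t t' u :
  rule (App f t) u -> par f f' -> par t t' ->
  exists u', rule (App f' t') u' /\ par u u'.
Proof.
  intros Hr Hf Ht; inversion Hr; subst.
  - apply par_app2_inv in Hf as (z' & x' & -> & Hz & Hx); auto.
    apply par_atom_inv in Hz; [subst|discriminate].
    eexists; split; [apply rule_T|assumption].
  - apply par_app2_inv in Hf as (z' & x' & -> & Hz & Hx); auto.
    exists t'; split; [apply rule_F|assumption].
    apply (conv_resp _ _ _ _ Hz (par_refl Fc)); assumption.
  - apply par_app2_inv in Hf as (z' & x' & -> & Hz & Hx); auto.
    exists x'; split; [apply rule_C|assumption].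
    + apply (conv_resp _ _ _ _ Hx Ht); assumption.
    + rewrite <- (conv_resp _ _ _ _ Hz (par_refl Fc)); assumption.
  - apply par_app1_inv in Hf as (x' & -> & Hx); [|discriminate].
    exists x'; split; [apply rule_K|assumption].
  - apply par_app2_inv in Hf as (x' & y' & -> & Hx & Hy); auto.
    eexists; split; [apply rule_S|].
    repeat apply par_app; assumption.
Qed.

Lemma par_app_inv f t u :
  par (App f t) u -> exists f' t', par f f' /\ par t t' /\
  (u = App f' t' \/ rule (App f' t') u).
Proof.
  inversion 1 as [? Hn| |]; subst; [now destruct (Hn f t)| |]; eauto 8.
Qed.

(** [par_rule] contracts at the root after the immediate subterms have been reduced, so these are
    joined by induction and root contractions are then carried over with [rule_par]. *)
Lemma par_diamond t u v :
  par t u -> par t v -> exists w, par u w /\ par v w.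
Proof.
  revert u v; induction t as [n| | | | | |f IHf t IHt]; intros u v Hu Hv;
    try (apply par_atom_inv in Hu, Hv; try discriminate; subst;
         eexists; split; apply par_refl).
  apply par_app_inv in Hu as (f1 & t1 & Hf1 & Ht1 & Hu).
  apply par_app_inv in Hv as (f2 & t2 & Hf2 & Ht2 & Hv).
  destruct (IHf _ _ Hf1 Hf2) as (f3 & Hf13 & Hf23).
  destruct (IHt _ _ Ht1 Ht2) as (t3 & Ht13 & Ht23).
  destruct Hu as [->|Hu], Hv as [->|Hv].
  - exists (App f3 t3); split; apply par_app; assumption.
  - destruct (rule_par _ _ _ _ _ Hv Hf23 Ht23) as (w & Hw & Hvw).
    exists w; split; [eapply par_rule; eassumption|assumption].
  - destruct (rule_par _ _ _ _ _ Hu Hf13 Ht13) as (w & Hw & Huw).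
    exists w; split; [assumption|eapply par_rule; eassumption].
  - destruct (rule_par _ _ _ _ _ Hu Hf13 Ht13) as (w & Hw & Huw).
    destruct (rule_par _ _ _ _ _ Hv Hf23 Ht23) as (w' & Hw' & Hvw).
    (* [w] and [w'] are contracta of the same term [App f3 t3]. *)
    rewrite (rule_functional _ _ _ Hw' Hw) in Hvw; eauto.
Qed.

(** * Confluence of iterated parallel reduction *)

Definition pars : relation term := clos_refl_trans_1n term par.

Lemma pars_trans t u v : pars t u -> pars u v -> pars t v.
Proof.
  intros H Hv; induction H as [|t t1 u H _ IH]; [assumption|].
  eapply Relation_Operators.rt1n_trans; [exact H|apply IH, Hv].
Qed.

Lemma par_pars t u : par t u -> pars t u.
Proof. intros H; eapply Relation_Operators.rt1n_trans; [exact H|apply rt1n_refl]. Qed.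

Lemma pars_strip t u v :
  pars t u -> par t v -> exists w, par u w /\ pars v w.
Proof.
  intros H; revert v; induction H as [t|t t1 u H _ IH]; intros v Hv.
  - exists v; split; [assumption|apply rt1n_refl].
  - destruct (par_diamond _ _ _ H Hv) as (w1 & H1 & H2).
    destruct (IH _ H1) as (w & H3 & H4).
    exists w; split; [assumption|eapply Relation_Operators.rt1n_trans; eassumption].
Qed.

Lemma pars_confluent t u v :
  pars t u -> pars t v -> exists w, pars u w /\ pars v w.
Proof.
  intros Hu Hv; revert u Hu; induction Hv as [t|t t1 v H _ IH]; intros u Hu.
  - exists u; split; [apply rt1n_refl|assumption].
  - destruct (pars_strip _ _ _ Hu H) as (w1 & H1 & H2).
    destruct (IH _ H2) as (w & H3 & H4).
    exists w; split; [eapply Relation_Operators.rt1n_trans; eassumption|assumption].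
Qed.

Lemma pars_app t t' u u' :
  pars t t' -> pars u u' -> pars (App t u) (App t' u').
Proof.
  intros Ht Hu; apply pars_trans with (App t' u).
  - induction Ht; [apply rt1n_refl|].
    eapply Relation_Operators.rt1n_trans; [apply par_app; [eassumption|apply par_refl]|assumption].
  - clear Ht; induction Hu; [apply rt1n_refl|].
    eapply Relation_Operators.rt1n_trans; [apply par_app; [apply par_refl|eassumption]|assumption].
Qed.

Lemma pars_steps t u : pars t u -> clc_steps plus t u.
Proof.
  induction 1; [apply rt_refl|].
  eapply rt_trans; [apply par_steps|]; eassumption.
Qed.

(** * Joinability contains conversion *)

Definition joinable : relation term := fun t u =>
  exists w, pars t w /\ pars u w.

Lemma joinable_conv t u : joinable t u -> conv plus t u.
Proof.
  intros (w & Ht & Hu); apply pars_steps, steps_conv in Ht, Hu.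
  eapply rst_trans; [exact Ht|apply rst_sym, Hu].
Qed.

Lemma rule_joinable f t u : rule (App f t) u -> joinable (App f t) u.
Proof.
  intros H; exists u; split; [|apply rt1n_refl].
  apply par_pars; eapply par_rule; [apply par_refl|apply par_refl|exact H].
Qed.

Lemma joinable_trans t u v : joinable t u -> joinable u v -> joinable t v.
Proof.
  intros (w1 & H1 & H2) (w2 & H3 & H4).
  destruct (pars_confluent _ _ _ H2 H3) as (w & H5 & H6).
  exists w; split; eapply pars_trans; eassumption.
Qed.

Lemma joinable_theory : clc_theory joinable.
Proof.
  split.
  - intros t; exists t; split; apply rt1n_refl.
  - intros t u (w & H1 & H2); exists w; auto.
  - apply joinable_trans.
  - intros t t' u (w & H1 & H2); exists (App w u); split;
      apply pars_app; auto; apply rt1n_refl.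
  - intros t u u' (w & H1 & H2); exists (App t w); split;
      apply pars_app; auto; apply rt1n_refl.
  - intros x y; apply rule_joinable, rule_T.
  - intros x y; apply rule_joinable, rule_F, rst_refl.
  - intros x y; apply rule_joinable, rule_K.
  - intros x y z; apply rule_joinable, rule_S.
  - intros z x y H.
    (* If [z = F], the contraction goes to [y], and joinability of [x] and [y] leads back to [x];
       otherwise [rule_C] applies, its condition coming from [joinable_conv]. *)
    destruct (classic (conv plus z Fc)) as [Hz|Hz].
    + apply joinable_trans with y; [apply rule_joinable, rule_F, Hz|].
      destruct H as (w & H1 & H2); exists w; auto.
    + apply rule_joinable, rule_C; [apply joinable_conv, H|exact Hz].
Qed.

End Orthogonal.

Theorem mainTheorem1 : forall (plus : bool) (q q1 q2 : term),
  clc_steps plus q q1 -> clc_steps plus q q2 ->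
  exists q', clc_steps plus q1 q' /\ clc_steps plus q2 q'.
Proof.
  intros plus q q1 q2 H1 H2.
  assert (H : conv plus q1 q2).
  { eapply rst_trans; [apply rst_sym, steps_conv, H1|apply steps_conv, H2]. }
  (* Convertible terms are joinable by [pars], which consists of reductions of the original
     system. *)
  apply (conv_least _ _ (joinable_theory plus)) in H.
  destruct H as (w & Hw1 & Hw2).
  exists w; split; apply pars_steps; assumption.
Qed.
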